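(* Any $n$-dimensional metric $lc^n_G$-space is an $AANR_G$.
   Context: Conventions: all spaces are paracompact, maps are continuous; $G$ is a commutative ring with unit; $n\ge0$ is an integer; dimension is covering dimension; $H_k(\cdot;G)$ is singular homology, reduced in dimension $0$. A space $X$ is $lc^n_G$ (homologically locally connected in dimension $n$ with respect to $G$) if for every $x\in X$ every neighborhood $U$ of $x$ contains another neighborhood $V$ of $x$ such that the inclusion induces trivial homomorphisms $H_k(V;G)\to H_k(U;G)$ for all $k\le n$. A chain morphism is a sequence of homomorphisms of $G$-modules (degree by degree) commuting with the boundaries and, in degree $0$, with the augmentations. $S(X;G)$ is the singular chain complex of $X$; for an open cover $\alpha$ of $W$, $S(W,\alpha;G)$ is the subcomplex of $S(W;G)$ generated by all singular simplexes whose carrier lies in some element of $\alpha$; for $X\subset W$, $S(X,\alpha;G)$ is generated by all singular simplexes of $X$ whose carrier lies in some element of $\alpha$. The carrier of a singular simplex $\sigma:\triangle^k\to X$ is $|\sigma|=\sigma(\triangle^k)$; for a chain $c=\sum_i g_i\sigma_i$ (irreducible representation) $|c|=\bigcup_i|\sigma_i|$, and $|0|=\varnothing$. A face of a singular simplex $\sigma$ defined on $\triangle^k$ is the restriction of $\sigma$ to a face of $\triangle^k$. For an open cover $\mathcal U$ of $X$, two chain morphisms $\varphi,\psi$ from a singular complex (or subcomplex spanned by singular simplexes) to $S(X;G)$ are $\mathcal U$-close if for each singular simplex $\sigma$ of the domain there is $U_\sigma\in\mathcal U$ with $|\varphi(\tau)|\cup|\psi(\tau)|\subset U_\sigma$ for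 all faces $\tau$ of $\sigma$. A metric space $X$ is an $AANR_G$ (approximate absolute neighborhood $G$-retract) if for every embedding of $X$ as a closed subset of a metric space $Y$ and every open cover $\mathcal U$ of $X$ there are a neighborhood $W$ of $X$ in $Y$, an open cover $\alpha$ of $W$ and a chain morphism $\phi:S(W,\alpha;G)\to S(X;G)$ such that $\phi|S(X,\alpha;G)$ and the identity morphism on $S(X,\alpha;G)$ (viewed as a morphism into $S(X;G)$) are $\mathcal U$-close. *)

(* Defs.v *)
From HB Require Import structures.
From mathcomp Require Import all_boot all_order all_algebra.
From mathcomp Require Import all_classical reals topology normedtype.

Set Implicit Arguments.
Unset Strict Implicit.
Unset Printing Implicit Defensive.
Import Order.TTheory GRing.Theory Num.Theory.
Import numFieldNormedType.Exports.
Local Open Scope classical_set_scope.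
Local Open Scope ring_scope.
Local Open Scope quotient_scope.

Section FreeModule.
Variables (G : comPzRingType) (K : choiceType).

Definition finite_fm_coef : {pred K -> G^o} :=
  fun c => `[< finite_set (c @^-1` [set~ 0]) >].

Lemma finite_fm_coefP : subsemimod_closed finite_fm_coef.
Proof.
split=> [|a c]; last first.
  rewrite !unfold_in => /asboolP fc; apply/asboolP.
  apply: sub_finite_set fc => k /= ack ck0; apply: ack.
  by rewrite {1}/GRing.scale/= ck0 scaler0.
split=> [|c c']; rewrite !unfold_in.
  by apply/asboolP; rewrite (_ : _ @^-1` _ = set0)// -subset0 => k /=.
move=> /asboolP fc /asboolP fc'; apply/asboolP.
have : finite_set (c @^-1` [set~ 0] `|` c' @^-1` [set~ 0]).
  by rewrite finite_setU.
apply: sub_finite_set => k /= ck; have [c0|] := pselect (c k = 0); last by left.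
by right=> c'0; apply: ck; rewrite /GRing.add/= c0 c'0 addr0.
Qed.

HB.instance Definition _ :=
  GRing.isSubSemiModClosed.Build G (K -> G^o) finite_fm_coef finite_fm_coefP.

Record free_module := FreeModule {
  fm_coef :> K -> G^o;
  _ : fm_coef \in finite_fm_coef }.

HB.instance Definition _ := [isSub for fm_coef].
HB.instance Definition _ := [Choice of free_module by <:].
HB.instance Definition _ := [SubChoice_isSubLmodule of free_module by <:].

Definition fsupp (c : free_module) : set K := [set k | c k <> 0].

Lemma finite_fsupp (c : free_module) : finite_set (fsupp c).
Proof. by move: (valP c); rewrite unfold_in => /asboolP. Qed.

Lemma gen_subproof (k : K) :
  (fun k' => (k' == k)%:R : G^o) \in finite_fm_coef.
Proof.
apply/asboolP; apply: sub_finite_set (finite_set1 k) => k' /=.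
by case: eqP.
Qed.

Definition gen (k : K) : free_module := FreeModule (gen_subproof k).

Lemma fm_coefD c c' k : (c + c' : free_module) k = c k + c' k.
Proof. by []. Qed.
Lemma fm_coefZ a c k : (a *: c : free_module) k = a * c k.
Proof. by []. Qed.
Lemma fm_coef0 k : (0 : free_module) k = 0.
Proof. by []. Qed.
Lemma fm_coef_gen k k' : gen k k' = (k' == k)%:R.
Proof. by []. Qed.

Lemma fsupp_gen k : fsupp (gen k) `<=` [set k].
Proof.
by move=> k'; rewrite /fsupp /mkset fm_coef_gen; have [->|//] := eqVneq k' k.
Qed.

Section LinExt.
Variables (V : lmodType G) (f : K -> V).

Definition lin_ext (c : free_module) : V := \sum_(k \in [set: K]) c k *: f k.

Lemma lin_extE (X : set K) c : fsupp c `<=` X ->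
  lin_ext c = \sum_(k \in X) c k *: f k.
Proof.
move=> cX; rewrite /lin_ext; apply/esym/fsbig_widen => // k [_ /= nXk].
by have [->|ck] := pselect (c k = 0); [rewrite scale0r|case: nXk; exact: cX].
Qed.

Lemma lin_ext_linear : linear lin_ext.
Proof.
move=> a c c'; pose X := fsupp c `|` fsupp c'.
have fX : finite_set X by rewrite finite_setU; split; exact: finite_fsupp.
rewrite !(@lin_extE X).
- rewrite !fsbig_finite// scaler_sumr -big_split; apply: eq_bigr => k _.
  by rewrite fm_coefD fm_coefZ scalerDl scalerA.
- by move=> k; right.
- by move=> k; left.
- move=> k /= ck; have [c0|] := pselect (c k = 0); last by left.
  by right=> c'0; apply: ck; rewrite fm_coefD fm_coefZ c0 c'0 mulr0 addr0.
Qed.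

HB.instance Definition _ :=
  GRing.isLinear.Build G free_module V _ lin_ext lin_ext_linear.

Lemma lin_ext_gen k : lin_ext (gen k) = f k.
Proof.
by rewrite (lin_extE (@fsupp_gen k)) fsbig_set1 fm_coef_gen eqxx scale1r.
Qed.

End LinExt.

Lemma fm_coef_sum I (r : seq I) (P : pred I) (c : I -> free_module) k :
  (\sum_(i <- r | P i) c i) k = \sum_(i <- r | P i) c i k.
Proof.
exact: (big_morph (fun c : free_module => c k) (fun c c' => fm_coefD c c' k)
  (fm_coef0 k)).
Qed.

Lemma lin_ext_id c : lin_ext gen c = c.
Proof.
apply/val_inj/funext => k; rewrite (@lin_extE _ gen (fsupp c))//.
rewrite fsbig_finite; last exact: finite_fsupp.
rewrite [LHS]fm_coef_sum; under eq_bigr do rewrite fm_coefZ fm_coef_gen.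
have [ck|ck] := pselect (c k = 0).
  rewrite [RHS]ck big1// => j _.
  by have [<-|] := eqVneq k j; rewrite ?ck (mul0r, mulr0).
rewrite (bigD1_seq k)/= ?finmap.fset_uniq//; last first.
  by rewrite in_fset_set ?inE//; exact: finite_fsupp.
rewrite eqxx mulr1 big1 ?addr0// => j jk.
by rewrite eq_sym (negbTE jk) mulr0.
Qed.

Lemma free_module_ind (P : free_module -> Prop) :
  P 0 -> (forall a k c, P c -> P (a *: gen k + c)) -> forall c, P c.
Proof.
move=> P0 PD c; rewrite -(lin_ext_id c) /lin_ext.
elim: (finite_support _ _ _) => [|k r IHr]; first by rewrite big_nil.
by rewrite big_cons; exact: PD.
Qed.

Lemma eq_linear_gen (V : lmodType G) (f g : {linear free_module -> V}) :
  (forall k, f (gen k) = g (gen k)) -> f =1 g.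
Proof.
move=> fg; elim/free_module_ind => [|a k c fgc]; first by rewrite !raddf0.
by rewrite !linearP fg fgc.
Qed.

End FreeModule.

Record chain_complex (G : comPzRingType) := ChainComplex {
  chain :> nat -> lmodType G;
  bd : forall k, {linear chain k.+1 -> chain k};
  aug : {linear chain 0 -> G^o};
  bd_bd : forall k c, bd k (bd k.+1 c) = 0;
  aug_bd : forall c, aug (bd 0 c) = 0 }.

Record chain_morphism (G : comPzRingType) (C D : chain_complex G) :=
  ChainMorphism {
  chain_map :> forall k, {linear C k -> D k};
  chain_map_bd : forall k c, chain_map k (bd C k c) = bd D k (chain_map k.+1 c);
  chain_map_aug : forall c, aug D (chain_map 0 c) = aug C c }.

Section Composition.
Variables (G : comPzRingType) (C D E : chain_complex G).
Variables (g : chain_morphism D E) (f : chain_morphism C D).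

Definition comp_chain_map k : {linear C k -> E k} := g k \o f k.

Lemma comp_chain_map_bd k c :
  comp_chain_map k (bd C k c) = bd E k (comp_chain_map k.+1 c).
Proof. by rewrite /= !chain_map_bd. Qed.

Lemma comp_chain_map_aug c : aug E (comp_chain_map 0 c) = aug C c.
Proof. by rewrite /= !chain_map_aug. Qed.

Definition comp_morphism : chain_morphism C E :=
  ChainMorphism comp_chain_map_bd comp_chain_map_aug.

End Composition.

Lemma kernel_closed (G : comPzRingType) (V W : lmodType G)
    (f : {linear V -> W}) : subsemimod_closed [pred v | f v == 0].
Proof.
split=> [|a v /eqP fv]; last by apply/eqP; rewrite linearZ_LR [f v]fv scaler0.
split=> [|v v' /eqP fv /eqP fv']; apply/eqP; first exact: raddf0.
by rewrite linearD [f v]fv [f v']fv' addr0.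
Qed.

(* Homology of the augmented complex: in degree 0 the cycles are the chains  *)
(* of augmentation 0, which makes H_0 reduced.                               *)
Section Homology.
Variables (G : comPzRingType) (C : chain_complex G).

Definition cycles_pred k : {pred C k} :=
  match k return {pred C k} with
  | 0 => [pred c | aug C c == 0]
  | k'.+1 => [pred c | bd C k' c == 0]
  end.

Lemma cycles_predP k : subsemimod_closed (@cycles_pred k).
Proof. by case: k => [|k]; exact: kernel_closed. Qed.

HB.instance Definition _ k :=
  GRing.isSubSemiModClosed.Build G (C k) (@cycles_pred k) (@cycles_predP k).

Record cycles k := Cycles {
  cycles_val : C k;
  _ : cycles_val \in @cycles_pred k }.

HB.instance Definition _ k := [isSub for @cycles_val k].
HB.instance Definition _ k := [Choice of cycles k by <:].
HB.instance Definition _ k := [SubChoice_isSubLmodule of cycles k by <:].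

Definition boundary k : {pred cycles k} :=
  fun z => `[< exists c : C k.+1, bd C k c = cycles_val z >].

Lemma boundaryP k : zmod_closed (@boundary k).
Proof.
split=> [|z z']; rewrite !unfold_in.
  by apply/asboolP; exists 0; rewrite raddf0.
move=> /asboolP[c cz] /asboolP[c' cz']; apply/asboolP; exists (c - c').
by rewrite raddfB/= cz cz'.
Qed.

HB.instance Definition _ k :=
  GRing.isZmodClosed.Build (cycles k) (@boundary k) (@boundaryP k).

Definition homology k : zmodType := Quotient.quot (@boundary k).

End Homology.

Section InducedMap.
Variables (G : comPzRingType) (C D : chain_complex G).
Variables (f : chain_morphism C D) (k : nat).

Lemma cycles_map_subproof (z : cycles C k) :
  f k (cycles_val z) \in @cycles_pred G D k.
Proof.
case: k z => [|k'] [z /=]; rewrite !unfold_in /= => /eqP z0.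
  by rewrite chain_map_aug z0.
by rewrite -chain_map_bd z0 raddf0.
Qed.

Definition cycles_map (z : cycles C k) : cycles D k :=
  Cycles (cycles_map_subproof z).

Definition homology_map (h : homology C k) : homology D k :=
  \pi_(homology D k) (cycles_map (repr h)).

Lemma homology_mapE (z : cycles C k) :
  homology_map (\pi_(homology C k) z) = \pi_(homology D k) (cycles_map z).
Proof.
apply/eqP; rewrite -Quotient.idealrBE unfold_in.
have : repr (\pi_(homology C k) z) - z \in @boundary G C k.
  by rewrite Quotient.idealrBE reprK.
rewrite unfold_in => /asboolP[c cz]; apply/asboolP; exists (f k.+1 c).
by rewrite -chain_map_bd cz /= raddfB.
Qed.

Lemma homology_map_zmod_morphism : zmod_morphism homology_map.
Proof.
move=> h h'; rewrite -[h]reprK -[h']reprK -raddfB !homology_mapE -raddfB.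
by congr (\pi_(homology D k) _); apply/val_inj; rewrite /= raddfB.
Qed.

HB.instance Definition _ :=
  GRing.isZmodMorphism.Build (homology C k) (homology D k) homology_map
    homology_map_zmod_morphism.

End InducedMap.

Definition std_simplex (R : realType) (n : nat) : set 'rV[R]_n.+1 :=
  [set x | (forall i, 0 <= x ord0 i) /\ \sum_i x ord0 i = 1].
Arguments std_simplex : clear implicits.

(* The affine map of standard simplexes that sends the vertex e_i to e_(h i). *)
Section SimplexMap.
Variables (R : realType) (m n : nat) (h : 'I_m.+1 -> 'I_n.+1).

Definition simplex_row (x : 'rV[R]_m.+1) : 'rV[R]_n.+1 :=
  \row_j \sum_(i | h i == j) x ord0 i.

Lemma simplex_rowP (x : std_simplex R m) :
  simplex_row (set_val x) \in std_simplex R n.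
Proof.
have [x0 x1] := set_valP x; apply/mem_set; split=> [j|].
  by rewrite mxE sumr_ge0.
rewrite -[RHS]x1 (partition_big h xpredT)//=; apply: eq_bigr => j _.
by rewrite mxE.
Qed.

Definition simplex_fun (x : std_simplex R m) : std_simplex R n :=
  SigSub (simplex_rowP x).

Lemma simplex_row_continuous : continuous simplex_row.
Proof.
suff H (x : 'rV[R]_m.+1) (A : set 'rV[R]_n.+1) : nbhs (simplex_row x) A ->
    \forall y \near x, A (simplex_row y) by move=> x A; exact: H.
move=> [P Px PA].
have cj j : \forall y \near x, P ord0 j (simplex_row y ord0 j).
  have : continuous (fun y : 'rV[R]_m.+1 => simplex_row y ord0 j).
    under eq_fun do rewrite mxE.
    apply: continuous_big => [|i _]; first exact: add_continuous.
    exact: coord_continuous.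
  by move=> /(_ x) cx; exact: (cx _ (Px ord0 j)).
have := @filter_forall _ _ (fun j y => P ord0 j (simplex_row y ord0 j)) (nbhs x)
  (nbhs_filter x) cj.
by apply: filterS => y Py; apply: PA => i j; rewrite (ord1 i).
Qed.

Lemma simplex_fun_continuous : continuous simplex_fun.
Proof.
apply: continuous_comp_initial => x.
apply: (@continuous_comp _ _ _ set_val simplex_row).
  exact: initial_continuous.
exact: simplex_row_continuous.
Qed.

HB.instance Definition _ :=
  isContinuous.Build _ _ simplex_fun simplex_fun_continuous.

End SimplexMap.

Lemma simplex_fun_comp (R : realType) (l m n : nat)
    (h : 'I_m.+1 -> 'I_n.+1) (g : 'I_l.+1 -> 'I_m.+1) (x : std_simplex R l) :
  simplex_fun h (simplex_fun g x) = simplex_fun (h \o g) x.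
Proof.
apply/val_inj/rowP => j /=; rewrite !mxE.
under eq_bigr do rewrite mxE.
rewrite (partition_big g (fun i => h i == j))//=.
apply: eq_bigr => i hij; apply: eq_bigl => i'.
by have [->|] := eqVneq (g i') i; rewrite ?andbF// hij.
Qed.

Section Simplex.
Variables (R : realType) (T : topologicalType).

Definition simplex k := continuousType (std_simplex R k) T.

HB.instance Definition _ k := Choice.on (simplex k).

Definition face m k (s : simplex k) (h : 'I_m.+1 -> 'I_k.+1) : simplex m :=
  s \o simplex_fun h.

Lemma face_comp l m k (s : simplex k) (h : 'I_m.+1 -> 'I_k.+1)
    (g : 'I_l.+1 -> 'I_m.+1) : face (face s h) g = face s (h \o g).
Proof. by apply/continuousEP => x; rewrite /= simplex_fun_comp. Qed.

Lemma face_range m k (s : simplex k) (h : 'I_m.+1 -> 'I_k.+1) :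
  range (face s h) `<=` range s.
Proof. by move=> _ [x _ <-]; exists (simplex_fun h x). Qed.

(* t is the restriction of s to a face of the domain of s: the vertices of   *)
(* the face are listed increasingly by h.                                    *)
Definition is_face m k (t : simplex m) (s : simplex k) : Prop :=
  exists2 h : 'I_m.+1 -> 'I_k.+1, {homo h : i j / (i < j)%N} & t = face s h.

End Simplex.

Lemma alternating_sum0 (V : zmodType) k (F : 'I_k.+2 -> 'I_k.+1 -> V) :
  (forall (i i' : 'I_k.+2) (j j' : 'I_k.+1),
     i' = j.+1 :> nat -> j' = i :> nat ->
     (i <= j)%N -> F i' j' = - F i j) ->
  \sum_i \sum_j F i j = 0.
Proof.
move=> FN; rewrite pair_bigA/=.
rewrite (bigID (fun p : 'I_k.+2 * 'I_k.+1 => p.1 <= p.2)%N)/=.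
pose h (p : 'I_k.+2 * 'I_k.+1) := (lift ord0 p.2, inord p.1) : 'I_k.+2 * 'I_k.+1.
pose h' (p : 'I_k.+2 * 'I_k.+1) := (inord p.2, inord p.1.-1) : 'I_k.+2 * 'I_k.+1.
rewrite [X in _ + X](reindex_onto h h') => [|[i j]]/=; last first.
  rewrite -ltnNge => ji; have i0 : (0 < i)%N by exact: leq_ltn_trans ji.
  have jk : (j < k.+2)%N by exact: leqW.
  have ik : (i.-1 < k.+1)%N by rewrite -ltnS prednK// ltn_ord.
  congr pair; apply/val_inj; rewrite /= ?inordK//=.
  by rewrite /bump add1n prednK.
rewrite [X in _ + X](eq_bigl
  (fun p : 'I_k.+2 * 'I_k.+1 => p.1 <= p.2)%N) => [|[i j]]/=.
  rewrite -big_split/= big1// => -[i j]/= ij.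
  have ik : (i < k.+1)%N by exact: leq_ltn_trans ij (ltn_ord j).
  by rewrite (FN i (lift ord0 j) j (inord i)) ?subrr ?inordK.
have [ik|ki] := ltnP i k.+1.
  rewrite !inordK//= /bump add1n -ltnNge ltnS.
  rewrite (_ : (_ == _) = true) ?andbT//; apply/eqP; congr pair.
    by apply/val_inj; rewrite /= !inordK// leqW.
  by apply/val_inj; rewrite /= /bump add0n inordK.
rewrite [RHS]leqNgt (leq_trans (ltn_ord j) ki)/=; apply/negbTE; rewrite negb_and.
apply/orP; right; apply/eqP => -[/(congr1 val)/= + _].
rewrite inordK; last by exact: leqW.
move=> iE; have := ltn_ord (inord i : 'I_k.+1).
by rewrite iE ltnNge ki.
Qed.

Section SingularComplex.
Variables (R : realType) (G : comPzRingType) (T : topologicalType).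
Local Notation simplex := (simplex R T).

Definition singular_chain k := free_module G (simplex k).

Definition simplex_bd k (s : simplex k.+1) : singular_chain k :=
  \sum_(i < k.+2) (-1) ^+ i *: gen G (face s (lift i)).

Definition singular_bd k : {linear singular_chain k.+1 -> singular_chain k} :=
  lin_ext (@simplex_bd k).

Definition singular_aug : {linear singular_chain 0 -> G^o} :=
  lin_ext (fun=> 1 : G^o).

Lemma lift_lift k (i i' : 'I_k.+3) (j j' : 'I_k.+2) : i' = j.+1 :> nat ->
  j' = i :> nat -> (i <= j)%N -> lift i' \o lift j' =1 lift i \o lift j.
Proof.
move=> i'j j'i ij x; apply/val_inj; rewrite /= i'j j'i [RHS]bumpC.
by rewrite /unbump ltnNge ij subn0 [bump i j]/bump ij add1n.
Qed.

Lemma singular_bd_gen k (s : simplex k.+1) :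
  singular_bd k (gen G s) = simplex_bd s.
Proof. exact: lin_ext_gen. Qed.

Lemma singular_bd_bd k c : singular_bd k (singular_bd k.+1 c) = 0.
Proof.
elim/free_module_ind: c => [|a s c IHc]; first by rewrite !raddf0.
rewrite !linearP IHc addr0 singular_bd_gen.
rewrite -[RHS](scaler0 _ a); congr (_ *: _).
rewrite linear_sum/=; under eq_bigr => i _.
  rewrite linearZ/= singular_bd_gen scaler_sumr.
  under eq_bigr do rewrite scalerA face_comp.
  over.
apply: alternating_sum0 => i i' j j' i'j j'i ij.
rewrite i'j j'i exprS mulN1r mulNr scaleNr [in LHS]mulrC.
by congr (- (_ *: gen G (face s _))); apply/funext/lift_lift.
Qed.

Lemma singular_aug_bd c : singular_aug (singular_bd 0 c) = 0.
Proof.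
elim/free_module_ind: c => [|a s c IHc]; first by rewrite !raddf0.
rewrite !linearP IHc addr0 singular_bd_gen /simplex_bd !big_ord_recl big_ord0.
rewrite addr0 linearD/= !linearZ_LR/= /singular_aug/= !lin_ext_gen.
by rewrite expr0 expr1 scale1r scaleN1r subrr scaler0.
Qed.

Definition singular : chain_complex G :=
  ChainComplex singular_bd_bd singular_aug_bd.

End SingularComplex.

Lemma lin_ext_closed (G : comPzRingType) (K : choiceType) (V : lmodType G)
    (S : submodClosed V) (f : K -> V) (c : free_module G K) :
  (forall k, fsupp c k -> f k \in S) -> lin_ext f c \in S.
Proof.
move=> fS; rewrite (@lin_extE _ _ _ _ (fsupp c))//.
rewrite fsbig_finite; last exact: finite_fsupp.
rewrite big_seq; apply: rpred_sum => k.
by rewrite in_fset_set ?inE; [move=> /fS; exact: rpredZ|exact: finite_fsupp].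
Qed.

(* S(T, alpha; G): the subcomplex of S(T; G) generated by the singular       *)
(* simplexes whose carrier lies in some element of alpha.                    *)
Section SmallComplex.
Variables (R : realType) (G : comPzRingType) (T : topologicalType).
Variable alpha : set (set T).
Local Notation simplex := (simplex R T).
Local Notation singular_chain := (singular_chain R G T).

Definition small k (s : simplex k) : Prop :=
  exists2 A, alpha A & range s `<=` A.

Lemma small_face m k (t : simplex m) (s : simplex k) :
  is_face t s -> small s -> small t.
Proof.
move=> [h _ ->] [A alphaA sA]; exists A => //.
exact: subset_trans (@face_range _ _ _ _ s h) sA.
Qed.

Definition small_pred k : {pred singular_chain k} :=
  fun c => `[< fsupp c `<=` @small k >].

Lemma small_predP k : subsemimod_closed (@small_pred k).
Proof.
split=> [|a c /asboolP sc]; last first.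
  apply/asboolP => s; rewrite /fsupp/mkset fm_coefZ => acs; apply: sc => /= cs.
  by apply: acs; rewrite cs mulr0.
split=> [|c c' /asboolP sc /asboolP sc']; apply/asboolP => s //.
rewrite /fsupp/mkset fm_coefD => cs.
have [c0|] := pselect (c s = 0); last exact: sc.
by apply: sc' => /= c'0; apply: cs; rewrite c0 c'0 addr0.
Qed.

HB.instance Definition _ k :=
  GRing.isSubSemiModClosed.Build G (singular_chain k) (@small_pred k)
    (@small_predP k).

Record small_chain k := SmallChain {
  small_val : singular_chain k;
  _ : small_val \in @small_pred k }.

HB.instance Definition _ k := [isSub for @small_val k].
HB.instance Definition _ k := [Choice of small_chain k by <:].
HB.instance Definition _ k := [SubChoice_isSubLmodule of small_chain k by <:].

Lemma small_fsupp k (c : small_chain k) s : fsupp (small_val c) s -> small s.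
Proof. by move: s; apply/asboolP; exact: (valP c). Qed.

Lemma small_gen_subproof k (s : simplex k) :
  small s -> gen G s \in @small_pred k.
Proof.
move=> ss; apply/asboolP => t ts.
by have -> : t = s := fsupp_gen ts. Qed.

Definition small_gen k (s : simplex k) (ss : small s) : small_chain k :=
  SmallChain (small_gen_subproof ss).

Lemma small_bd_subproof k (c : small_chain k.+1) :
  singular_bd R G T k (small_val c) \in @small_pred k.
Proof.
apply: lin_ext_closed => s cs; have [A alphaA sA] := small_fsupp cs.
apply: rpred_sum => i _; apply: rpredZ; apply: small_gen_subproof.
by exists A => //; apply: subset_trans sA; exact: face_range.
Qed.

Definition small_bd_fun k (c : small_chain k.+1) : small_chain k :=
  SmallChain (small_bd_subproof c).

Lemma small_bd_linear k : linear (@small_bd_fun k).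
Proof. by move=> a c c'; apply/val_inj; rewrite /= !linearP. Qed.

HB.instance Definition _ k := GRing.isLinear.Build G (small_chain k.+1)
  (small_chain k) _ (@small_bd_fun k) (@small_bd_linear k).

Definition small_bd k : {linear small_chain k.+1 -> small_chain k} :=
  @small_bd_fun k.

Definition small_aug : {linear small_chain 0 -> G^o} :=
  singular_aug R G T \o \val.

Lemma small_bd_bd k c : small_bd k (small_bd k.+1 c) = 0.
Proof. by apply/val_inj; exact: singular_bd_bd. Qed.

Lemma small_aug_bd c : small_aug (small_bd 0 c) = 0.
Proof. exact: singular_aug_bd. Qed.

Definition small_singular : chain_complex G :=
  ChainComplex small_bd_bd small_aug_bd.

Definition small_incl_map k : {linear small_chain k -> singular_chain k} :=
  \val.

Definition small_incl : chain_morphism small_singular (singular R G T) :=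
  @ChainMorphism G small_singular (singular R G T) small_incl_map
    (fun k c => erefl) (fun c => erefl).

End SmallComplex.

Section Pushforward.
Variables (R : realType) (G : comPzRingType) (T U : topologicalType).
Variable e : continuousType T U.

Definition push_simplex k (s : simplex R T k) : simplex R U k := e \o s.

Definition push_map k :
    {linear singular_chain R G T k -> singular_chain R G U k} :=
  lin_ext (fun s => gen G (push_simplex s)).

Lemma push_bd k c :
  push_map k (singular_bd R G T k c) = singular_bd R G U k (push_map k.+1 c).
Proof.
elim/free_module_ind: c => [|a s c IHc]; first by rewrite !raddf0.
rewrite !linearP IHc [push_map _ (gen _ _)]lin_ext_gen !singular_bd_gen.
congr (_ *: _ + _); rewrite linear_sum/=; apply: eq_bigr => i _.
by rewrite linearZ/= lin_ext_gen; congr (_ *: gen G _); exact/continuousEP.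
Qed.

Lemma push_aug c : singular_aug R G U (push_map 0 c) = singular_aug R G T c.
Proof.
elim/free_module_ind: c => [|a s c IHc]; first by rewrite !raddf0.
rewrite !linearP IHc [push_map _ (gen _ _)]lin_ext_gen.
by rewrite /singular_aug/= !lin_ext_gen.
Qed.

Definition push : chain_morphism (singular R G T) (singular R G U) :=
  @ChainMorphism G (singular R G T) (singular R G U) push_map push_bd push_aug.

(* S(T, alpha; G) for a family alpha of subsets of U, when T lies in U       *)
(* through e: the simplexes of T whose carrier, seen in U, is in an element  *)
(* of alpha.                                                                 *)
Definition trace (alpha : set (set U)) : set (set T) :=
  [set e @^-1` A | A in alpha].

Variable alpha : set (set U).

Lemma push_small_subproof k (c : small_chain R G (trace alpha) k) :
  push_map k (small_val c) \in @small_pred R G U alpha k.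
Proof.
apply: lin_ext_closed => s cs.
have [_ [A alphaA <-] sA] := small_fsupp cs.
apply: small_gen_subproof; exists A => // _ [x _ <-].
by apply: sA; exists x.
Qed.

Definition push_small_fun k (c : small_chain R G (trace alpha) k) :
  small_chain R G alpha k := SmallChain (push_small_subproof c).

Lemma push_small_linear k : linear (@push_small_fun k).
Proof. by move=> a c c'; apply/val_inj; rewrite /= !linearP. Qed.

HB.instance Definition _ k := GRing.isLinear.Build G
  (small_chain R G (trace alpha) k) (small_chain R G alpha k) _
  (@push_small_fun k) (@push_small_linear k).

Definition push_small_map k :
  {linear small_chain R G (trace alpha) k -> small_chain R G alpha k} :=
  @push_small_fun k.

Lemma push_small_bd k c :
  push_small_map k (small_bd R G (trace alpha) k c) =
  small_bd R G alpha k (push_small_map k.+1 c).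
Proof. by apply/val_inj; exact: push_bd. Qed.

Lemma push_small_aug c :
  small_aug R G alpha (push_small_map 0 c) = small_aug R G (trace alpha) c.
Proof. exact: push_aug. Qed.

Definition push_small :
    chain_morphism (small_singular R G (trace alpha)) (small_singular R G alpha) :=
  @ChainMorphism G (small_singular R G (trace alpha)) (small_singular R G alpha)
    push_small_map push_small_bd push_small_aug.

End Pushforward.

Section SubspaceMaps.
Variables (S T : topologicalType).

Section Corestriction.
Variables (e : continuousType S T) (B : set T) (eB : range e `<=` B).

Definition corestrict_fun (x : S) : B := SigSub (mem_set (eB (imageT e x))).

Lemma corestrict_continuous : continuous corestrict_fun.
Proof. by apply: continuous_comp_initial; exact: cts_fun. Qed.

HB.instance Definition _ :=
  isContinuous.Build S B corestrict_fun corestrict_continuous.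

Definition corestrict : continuousType S B := corestrict_fun.

End Corestriction.

Variables (A B : set T) (AB : A `<=` B).

Definition subspace_incl_fun (x : A) : B := SigSub (mem_set (AB (set_valP x))).

Lemma subspace_incl_continuous : continuous subspace_incl_fun.
Proof. by apply: continuous_comp_initial; exact: initial_continuous. Qed.

HB.instance Definition _ :=
  isContinuous.Build A B subspace_incl_fun subspace_incl_continuous.

Definition subspace_incl : continuousType A B := subspace_incl_fun.

End SubspaceMaps.

Definition carrier (R : realType) (G : comPzRingType) (T : topologicalType) k
    (c : singular_chain R G T k) : set T :=
  \bigcup_(s in fsupp c) range s.

Definition open_cover (T : topologicalType) (U : set (set T)) : Prop :=
  U `<=` open /\ \bigcup_(A in U) A = setT.

Definition close_morphisms (R : realType) (G : comPzRingType)
    (T X : topologicalType) (alpha : set (set T)) (U : set (set X))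
    (phi psi : chain_morphism (small_singular R G alpha) (singular R G X)) :=
  forall k (s : simplex R T k), small alpha s ->
    exists2 A, U A & forall m (t : simplex R T m) (tsmall : small alpha t),
      is_face t s ->
      carrier (phi m (small_gen G tsmall)) `|`
        carrier (psi m (small_gen G tsmall)) `<=` A.

(* dim T < m, for the covering dimension: every open cover of T has an open  *)
(* refinement with at most m members through any point. The covers are       *)
(* arbitrary, not only finite; the two conventions agree on paracompact      *)
(* Hausdorff spaces. The empty space is the one with dim T < 0.              *)
Definition covdim_lt (T : topologicalType) (m : nat) : Prop :=
  forall U : set (set T), open_cover U ->
    exists2 V : set (set T), open_cover V &
      (forall B, V B -> exists2 A, U A & B `<=` A) /\
      (forall x, ([set B | V B /\ B x] #<= `I_m)%card).

Definition has_covdim (T : topologicalType) (n : nat) : Prop :=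
  covdim_lt T n.+1 /\ ~ covdim_lt T n.

Definition lc (R : realType) (G : comPzRingType) (n : nat)
    (X : topologicalType) : Prop :=
  forall (x : X) (U : set X), nbhs x U ->
    exists (V : set X) (VU : V `<=` U), nbhs x V /\
      forall k, (k <= n)%N -> forall h : homology (singular R G V) k,
        homology_map (push R G (subspace_incl VU)) h = 0.

Definition closed_embedding (X Y : topologicalType) (e : X -> Y) : Prop :=
  [/\ injective e,
      forall A : set X, open A <-> exists2 B, open B & e @^-1` B = A &
      closed (range e)].

Definition AANR (R : realType) (G : comPzRingType) (X : metricType R) : Prop :=
  forall (Y : metricType R) (e : continuousType X Y), closed_embedding e ->
  forall U : set (set X), open_cover U ->
  exists (W : set Y) (eW : range e `<=` W) (alpha : set (set W))
    (phi : chain_morphism (small_singular R G alpha) (singular R G X)),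
    [/\ set_nbhs (range e) W,
        open_cover alpha &
        close_morphisms U
          (comp_morphism phi (push_small R G (corestrict eW) alpha))
          (small_incl R G (trace (corestrict eW) alpha))].

(* Main.v *)
(* Choose an open cover V of X of order at most n+1 and, for each tuple of
   members of V with a common point, a singular chain of X: the vertices give
   points, and lc^n fills the boundary of each further simplex of the nerve with
   control on its size. Making the assignment alternating forces it to vanish on
   tuples with a repetition, hence in all degrees above n, so that no filling
   beyond lc^n is ever needed. The sets V extend to open sets of Y with the same
   nerve, whose union is the neighborhood W. Choosing for every point of W an
   extended set that contains a sufficiently large ball about it sends a small
   singular simplex of W to a tuple with a common point, through its vertices;
   composing the two assignments gives the chain morphism. No homotopy is needed
   for closeness, only that all the carriers involved lie in one small ball. *)

Require Import Defs.
From mathcomp Require Import all_boot all_order all_algebra.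
From mathcomp Require Import fingroup perm.
From mathcomp Require Import all_classical reals topology normedtype.
From mathcomp Require Import lra.

Set Implicit Arguments.
Unset Strict Implicit.
Unset Printing Implicit Defensive.
Import Order.TTheory GRing.Theory Num.Theory.
Import numFieldNormedType.Exports.
Local Open Scope classical_set_scope.
Local Open Scope ring_scope.
Local Open Scope quotient_scope.

(** * Alternating functions on tuples *)

Section Alternating.
Variables (G : comPzRingType) (K : choiceType).

Definition tuple_bd (V : lmodType G) k (F : ('I_k.+1 -> K) -> V)
    (v : 'I_k.+2 -> K) : V :=
  \sum_(i < k.+2) (-1) ^+ i *: F (v \o lift i).

(** On a repetition the sign rule only makes twice the value vanish, too little when 2 is not
    invertible in [G]; hence the second clause. *)
Definition alternating (V : lmodType G) k (F : ('I_k -> K) -> V) : Prop :=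
  (forall (s : 'S_k) v, F (v \o s) = (-1) ^+ s *: F v) /\
  (forall v, ~ injective v -> F v = 0).

(** [t] is what [s] induces once [i] and its image [s i] are deleted; the parity is that of a
    cofactor expansion. *)
Lemma perm_lift k (s : 'S_k.+2) i :
  exists2 t : 'S_k.+1, s \o lift i = lift (s i) \o t &
    s = odd i (+) odd (s i) (+) t :> bool.
Proof.
pose f j := odflt j (unlift (s i) (s (lift i j))).
have fE j : lift (s i) (f j) = s (lift i j).
  rewrite /f; case: unliftP => [j' ->//|/perm_inj/eqP].
  by rewrite eq_sym (negbTE (neq_lift _ _)).
have fI : injective f.
  by move=> j j' /(congr1 (lift (s i))); rewrite !fE => /perm_inj/lift_inj.
exists (perm fI); first by apply/funext => j /=; rewrite permE fE.
rewrite -odd_lift_perm; congr odd_perm; apply/permP => j.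
by case: (unliftP i j) => [j' ->|->];
  rewrite (lift_perm_lift, lift_perm_id)// permE fE.
Qed.

(** A permutation of the entries permutes the signed faces up to a common sign. For equal entries at
    [a] and [b], only the faces omitting [a] or [b] can survive, and the transposition makes them
    cancel. *)
Lemma alternating_tuple_bd (V : lmodType G) k (F : ('I_k.+1 -> K) -> V) :
  alternating F -> alternating (tuple_bd F).
Proof.
move=> [Fs F0].
have Fl (s : 'S_k.+2) (v : 'I_k.+2 -> K) (i : 'I_k.+2) :
    (-1) ^+ i *: F ((v \o s) \o lift i) =
    (-1) ^+ s *: ((-1) ^+ s i *: F (v \o lift (s i))).
  have [t stE sE] := perm_lift s i.
  rewrite -compA stE compA Fs !scalerA sE.
  rewrite -(signr_odd _ i) -(signr_odd _ (s i)) -!signr_addb.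
  by congr ((-1) ^+ (nat_of_bool _) *: _); 
  case: (odd i); case: (odd (s i)); case: (odd_perm t).
split=> [s v|v vN].
  rewrite /tuple_bd scaler_sumr [RHS](reindex_inj (@perm_inj _ s))/=.
  by apply: eq_bigr.
have /injectivePn[a [b ab vab]] : ~~ injectiveb v by apply/negP => /injectiveP.
have vs : v \o tperm a b = v.
  by apply/funext => i /=; case: tpermP => [->|->|].
rewrite /tuple_bd (bigD1 a)//= (bigD1 b) 1?eq_sym//= big1 ?addr0 => [|i].
  have := Fl (tperm a b) v a.
  by rewrite vs tpermL odd_tperm ab expr1 scaleN1r => ->; rewrite addNr.
move=> /andP[ia ib]; rewrite F0 ?scaler0// => vI.
have [[a' aE _] [b' bE _]] := (unlift_some ia, unlift_some ib).
apply/negP: ab; rewrite aE bE; apply/negPn/eqP; congr lift; apply: vI.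
by rewrite /= -aE -bE.
Qed.

(* A value is chosen freely on one representative of each orbit of injective
   tuples under permutation of the entries; the others are forced. *)
Lemma alternating_choice (V : lmodType G) k (Q : ('I_k -> K) -> V -> Prop) :
  (forall (s : 'S_k) v c, Q v c -> Q (v \o s) ((-1) ^+ s *: c)) ->
  (forall v, injective v -> exists c, Q v c) ->
  exists2 F, alternating F & forall v, injective v -> Q v (F v).
Proof.
move=> Qs Qex.
pose O (v : 'I_k -> K) := [set v \o s | s in [set: 'S_k]].
have Os (s : 'S_k) v : O (v \o s) = O v.
  apply/seteqP; split=> _ [t _ <-].
    by exists (t * s)%g => //; apply/funext => i; rewrite /= permM.
  by exists (t * s^-1)%g => //; apply/funext => i; rewrite /= permM permKV.
pose r v := xget v (O v).
have Ov v : O v v by exists 1%g => //; apply/funext => i; rewrite /= perm1.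
have rs (s : 'S_k) v : r (v \o s) = r v.
  rewrite /r Os /xget; case: pselect => // -[]; exists v; exact/asboolP/Ov.
have /choice[p pE] v : exists s : 'S_k, v \o s = r v.
  by have [s _ sE] : O v (r v) := xgetI v (Ov v); exists s.
have /choice[f fQ] v : exists c, injective v -> Q v c.
  have [/Qex[c ?]|?] := pselect (injective v); last by exists 0.
  by exists c.
exists (fun v => if `[< injective v >] then (-1) ^+ p v *: f (r v) else 0).
  split=> [s v|v vN]; last by case: asboolP.
  case: asboolP => [vsI|vsN]; case: asboolP => [vI|vN]; rewrite ?scaler0//.
  - rewrite rs scalerA -signr_addb; congr ((-1) ^+ nat_of_bool _ *: _).
    (* Both permutations bring the injective tuple [v] to its representative. *)
    have -> : p v = (p (v \o s) * s)%g.
      apply/permP => i; apply: vI; rewrite permM.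
      have /(congr1 (fun u => u i))/= -> := pE v.
      by have /(congr1 (fun u => u i))/= := pE (v \o s); rewrite rs.
    by rewrite odd_permM addbC addbK.
  - case: vN => i j vij; apply: (can_inj (permKV s)); apply: vsI.
    by rewrite /= !permKV.
  - by case: vsN; apply: inj_comp => //; exact: perm_inj.
move=> v vI; case: asboolP => // _.
have vE : r v \o (p v)^-1%g = v.
  by rewrite -pE; apply/funext => i; rewrite /= permKV.
have := Qs (p v)^-1%g (r v) (f (r v)); rewrite vE odd_permV; apply; apply: fQ.
by rewrite -pE; apply: inj_comp => //; exact: perm_inj.
Qed.

Lemma tuple_bd_bd (V : lmodType G) k (F : ('I_k.+1 -> K) -> V)
    (v : 'I_k.+3 -> K) : tuple_bd (tuple_bd F) v = 0.
Proof.
rewrite /tuple_bd; under eq_bigr => i _.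
  rewrite scaler_sumr; under eq_bigr do rewrite scalerA -compA.
  over.
apply: alternating_sum0 => i i' j j' i'j j'i ij.
rewrite i'j j'i exprS mulN1r mulNr scaleNr [in LHS]mulrC.
by congr (- (_ *: F (v \o _))); apply/funext/lift_lift.
Qed.

Section Tower.
Variables (D : chain_complex G) (N : forall k, ('I_k.+1 -> K) -> Prop).
Variable Q : forall k, ('I_k.+1 -> K) -> D k -> Prop.
Hypothesis N_comp : forall m k v (h : 'I_m.+1 -> 'I_k.+1), N v -> N (v \o h).
Hypothesis Q0 : forall k (v : 'I_k.+1 -> K), Q v (0 : D k).
Hypothesis Q_perm : forall k (s : 'S_k.+1) v c,
  Q v c -> Q (v \o s) ((-1) ^+ s *: c).
Hypothesis Q_aug : forall v : 'I_1 -> K,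
  N v -> exists2 c : D 0, aug D c = 1 & Q v c.
Hypothesis Q_fill : forall k (v : 'I_k.+2 -> K) (c : 'I_k.+2 -> D k),
  N v -> injective v -> (forall i, Q (v \o lift i) (c i)) ->
  \sum_(i < k.+2) (-1) ^+ i *: c i \in @cycles_pred G D k ->
  exists2 d : D k.+1, bd D k d = \sum_(i < k.+2) (-1) ^+ i *: c i & Q v d.

Let good k (F : ('I_k.+1 -> K) -> D k) :=
  [/\ alternating F, forall v, N v -> Q v (F v) &
    forall v, N v -> tuple_bd F v \in @cycles_pred G D k].

Let N_perm k (s : 'S_k.+1) v : N (v \o s) -> N v.
Proof.
move=> /(@N_comp _ _ _ s^-1%g); congr N.
by apply/funext => i; rewrite /= permKV.
Qed.

(** An acyclic carrier argument: [N] singles out the simplexes of a nerve, [Q] controls size.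
    Fillings are requested on injective tuples only; elsewhere the value 0 works, because the
    boundary of an alternating function vanishes there too. *)
Lemma alternating_tower : exists F : forall k, ('I_k.+1 -> K) -> D k,
  [/\ forall v, N v -> aug D (F 0 v) = 1,
      forall k v, N v -> bd D k (F k.+1 v) = tuple_bd (F k) v,
      forall k v, ~ injective v -> F k v = 0 &
      forall k v, N v -> Q v (F k v)].
Proof.
have [F0 F0alt F0Q] : exists2 F0 : ('I_1 -> K) -> D 0, alternating F0 &
    forall v, injective v -> N v -> aug D (F0 v) = 1 /\ Q v (F0 v).
  apply: (alternating_choice (Q := fun v c => N v -> aug D c = 1 /\ Q v c))
    => [s v c cQ /N_perm/cQ[augc Qc]|v vI].
    split; last exact: Q_perm.
    have -> : s = 1%g by apply/permP => i; rewrite !ord1.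
    by rewrite odd_perm1 expr0 scale1r.
  have [/Q_aug[c augc Qc]|?] := pselect (N v); last by exists 0.
  by exists c.
have I1 (v : 'I_1 -> K) : injective v by move=> i j; rewrite !ord1.
have F0good : good F0.
  split=> // [v Nv|v Nv]; first by have [] := F0Q _ (I1 v) Nv.
  rewrite unfold_in /= /tuple_bd !big_ord_recl big_ord0 addr0 expr0 expr1.
  rewrite scale1r scaleN1r raddfB.
  have F01 i : aug D (F0 (v \o lift i)) = 1.
    by have [] := F0Q _ (I1 _) (N_comp (lift i) Nv).
  by rewrite subr_eq0; apply/eqP; exact: etrans (F01 _) (esym (F01 _)).
(* With [good F] as a premise, the recursion can be defined before its values are known to be
   good. *)
have step k (F : ('I_k.+1 -> K) -> D k) : exists F' : ('I_k.+2 -> K) -> D k.+1,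
    good F -> good F' /\ forall v, N v -> bd D k (F' v) = tuple_bd F v.
  have [[Falt FQ Fz]|nF] := pselect (good F); last by exists (fun=> 0).
  have [F' F'alt F'Q] : exists2 F', alternating F' & forall v, injective v ->
      N v -> bd D k (F' v) = tuple_bd F v /\ Q v (F' v).
    apply: (alternating_choice
        (Q := fun v c => N v -> bd D k c = tuple_bd F v /\ Q v c))
    => [s v c cQ /N_perm/cQ[bdc Qc]|v vI].
      split; last exact: Q_perm.
      by rewrite (proj1 (alternating_tuple_bd Falt)) -bdc linearZ.
    have [Nv|?] := pselect (N v); last by exists 0.
    have [d dE Qd] :=
      Q_fill Nv vI (fun i => FQ _ (N_comp (lift i) Nv)) (Fz _ Nv).
    by exists d.
  have F'bd v : N v -> bd D k (F' v) = tuple_bd F v.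
    move=> Nv; have [vI|vN] := pselect (injective v).
      by have [] := F'Q _ vI Nv.
    by rewrite (proj2 F'alt)// (proj2 (alternating_tuple_bd Falt))// raddf0.
  exists F' => _; split=> //; split=> // v Nv.
    have [vI|vN] := pselect (injective v); first by have [] := F'Q _ vI Nv.
    by rewrite (proj2 F'alt).
  rewrite unfold_in /= linear_sum/=; apply/eqP.
  rewrite -[RHS](tuple_bd_bd F v);  apply: eq_bigr => i _.
  by rewrite linearZ/= F'bd//; exact: N_comp.
pose S k F := projT1 (cid (step k F)).
pose F k := nat_rect (fun k => ('I_k.+1 -> K) -> D k) F0 S k.
have Fgood k : good (F k).
  by elim: k => // k /(projT2 (cid (step k (F k))))[].
exists F; split=> [v Nv|k v Nv|k v vN|k v Nv].
- by have [] := F0Q _ (I1 v) Nv.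
- by have [_] := projT2 (cid (step k (F k))) (Fgood k); apply.
- by have [[_ F0v] _ _] := Fgood k; exact: F0v.
- by have [_ + _] := Fgood k; apply.
Qed.

End Tower.

End Alternating.

(** * Radius functions in place of open covers *)

Section Radii.
Variables (R : realType) (X : metricType R).

Lemma mballE (x y : X) r : ball x r y = (mdist x y < r) :> Prop.
Proof. by rewrite ballEmdist. Qed.

Lemma open_mdistP (A : set X) :
  open A <-> forall x, A x -> exists2 r, 0 < r & forall y, mdist x y < r -> A y.
Proof.
rewrite openE; split=> oA x /oA.
  move=> /nbhs_ballP[r r0 rA]; exists r => // y yr.
  by apply: rA; rewrite mballE.
move=> [r r0 rA]; apply/nbhs_ballP; exists r => // y.
by rewrite mballE => /rA.
Qed.

Lemma open_mball (x : X) r : open (ball x r).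
Proof.
apply/open_mdistP => y; rewrite mballE => xy.
exists (r - mdist x y) => [|z]; first by rewrite subr_gt0.
by rewrite mballE => yz; have := metric_triangle x y z; lra.
Qed.

(* Half the supremum of the radii at most 1 of the balls about a point that lie
   in a member of the family. *)
Lemma lebesgue_function (O : set (set X)) : O `<=` open ->
  exists rho : X -> R,
    [/\ forall x y, rho x <= rho y + mdist x y,
        forall A x, O A -> A x -> 0 < rho x &
        forall x, 0 < rho x -> exists2 A, O A & ball x (rho x) `<=` A].
Proof.
move=> Oopen.
(* Adjoining 0 makes [E x] nonempty with nonnegative supremum; the bound 1 makes the supremum
   finite. *)
pose E x := [set r : R | r = 0 \/
  r <= 1 /\ exists2 A, O A & ball x r `<=` A].
have E0 x : E x !=set0 by exists 0; left.
have Eub x : has_ubound (E x).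
  by exists 1 => r [->//|[]].
have supE x r : E x r -> r <= sup (E x).
  by move=> Er; apply: ub_le_sup.
have sup_ge0 x : 0 <= sup (E x) by apply: supE; left.
exists (fun x => sup (E x) / 2); split=> [x y|A x OA Ax|x].
- suff : sup (E x) <= sup (E y) + mdist x y.
    by have := mdist_ge0 x y; lra.
  apply: ge_sup => // r [->|[r1 [A OA xA]]].
    by have := mdist_ge0 x y; have := sup_ge0 y; lra.
  suff : r - mdist x y <= sup (E y) by lra.
  apply: supE; right; split; first by have := mdist_ge0 x y; lra.
  exists A => // z; rewrite mballE => yz; apply: xA; rewrite mballE.
  by have := metric_triangle x y z; lra.
- have /open_mdistP/(_ x Ax)[r r0 rA] := Oopen _ OA.
  suff : Num.min r 1 <= sup (E x).
    have : 0 < Num.min r 1 by rewrite lt_min r0 ltr01.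
    by lra.
  apply: supE; right; split; first by rewrite ge_min lexx orbT.
  exists A => // y; rewrite mballE lt_min => /andP[xy _]; exact: rA.
- move=> S0; have [|r] := @sup_gt _ (E x) (sup (E x) / 2) (E0 x); first by lra.
  move=> [->|[r1 [A OA xA]] rS]; first by lra.
  by exists A => // y; rewrite mballE => yx; apply: xA; rewrite mballE; lra.
Qed.

(** A Lebesgue number varying with the point; the Lipschitz bound makes its values at nearby centres
    comparable. *)
Definition radius_function (lam : X -> R) : Prop :=
  (forall x, 0 < lam x) /\ (forall x y, lam x <= lam y + mdist x y).

Lemma radius_min lam mu : radius_function lam -> radius_function mu ->
  radius_function (fun x => Num.min (lam x) (mu x)).
Proof.
move=> [l0 lL] [m0 mL]; split=> [x|x y]; first by rewrite lt_min l0 m0.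
have := lL x y; have := mL x y; rewrite /Num.min /Order.min.
by case: ifP; case: ifP; lra.
Qed.

Lemma cover_radius (O : set (set X)) : open_cover O ->
  exists2 lam, radius_function lam &
    forall x, exists2 A, O A & ball x (lam x) `<=` A.
Proof.
move=> [Oopen Ocov]; have [rho [rhoL rho0 rhoO]] := lebesgue_function Oopen.
have pos x : 0 < rho x.
  have [A OA Ax] : (\bigcup_(A in O) A) x by rewrite Ocov.
  exact: rho0 OA Ax.
by exists rho => [|x]; [|exact: rhoO].
Qed.

End Radii.

(** * Chains carried by a subset, and local fillings *)

Lemma eq_linear_fsupp (G : comPzRingType) (K : choiceType) (V : lmodType G)
    (f g : {linear free_module G K -> V}) (c : free_module G K) :
  (forall k, fsupp c k -> f (gen G k) = g (gen G k)) -> f c = g c.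
Proof.
move=> fg; rewrite -(lin_ext_id c) (@lin_extE _ _ _ _ (fsupp c))//.
rewrite fsbig_finite; last exact: finite_fsupp.
rewrite !linear_sum; apply: eq_big_seq => k.
rewrite in_fset_set ?inE; last exact: finite_fsupp.
by move=> ck; rewrite !linearZ/= fg.
Qed.

Section Carriers.
Variables (R : realType) (G : comPzRingType) (X : topologicalType).

Lemma carrierP k (c : singular_chain R G X k) (A : set X) :
  carrier c `<=` A <-> c \in @small_pred R G X [set A] k.
Proof.
split=> [cA|/asboolP cA].
  apply/asboolP => s cs; exists A => // y sy.
  by apply: cA; exists s.
by move=> y [s /cA[_ -> sA]]; exact: sA.
Qed.

Lemma carrier_gen k (s : simplex R X k) : carrier (gen G s) `<=` range s.
Proof. by move=> x [t ts]; have -> : t = s := fsupp_gen ts. Qed.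

Lemma carrier0 k : carrier (0 : singular_chain R G X k) = set0.
Proof. by rewrite -subset0; apply/carrierP; exact: rpred0. Qed.

Variable A : set X.

Definition subspace_val : continuousType A X :=
  mkcts (@initial_continuous A X set_val).

(** Simplexes that leave [A] go to 0. The linear extension need not commute with boundaries, since
    such a simplex may have faces in [A], but it inverts [push] on chains carried by [A]. *)
Definition corestrict_simplex k (s : simplex R X k) : singular_chain R G A k :=
  if pselect (range s `<=` A) is left sA
  then gen G (corestrict sA : simplex R A k) else 0.

Definition corestrict_chain k :
    {linear singular_chain R G X k -> singular_chain R G A k} :=
  lin_ext (@corestrict_simplex k).

Lemma push_val_carrier k (c : singular_chain R G A k) :
  carrier (push R G subspace_val k c) `<=` A.
Proof.
apply/carrierP; apply: lin_ext_closed => s _; apply/carrierP.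
by apply: subset_trans (@carrier_gen _ _) _ => _ [x _ <-]; exact: set_valP.
Qed.

Lemma push_valK k : cancel (push R G subspace_val k) (corestrict_chain k).
Proof.
move=> c; rewrite -[RHS]/(idfun c).
apply: (@eq_linear_gen _ _ _ (corestrict_chain k \o push R G subspace_val k)).
move=> s /=; rewrite !lin_ext_gen /corestrict_simplex.
case: pselect => [sA|[]]; last by move=> _ [x _ <-]; exact: set_valP.
by congr gen; apply/continuousEP => x; apply/val_inj.
Qed.

Lemma corestrict_chainK k (c : singular_chain R G X k) : carrier c `<=` A ->
  push R G subspace_val k (corestrict_chain k c) = c.
Proof.
move=> cA; rewrite -[RHS]/(idfun c).
apply: (@eq_linear_fsupp _ _ _ (push R G subspace_val k \o corestrict_chain k)).
move=> s cs /=; rewrite lin_ext_gen /corestrict_simplex.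
case: pselect => [sA|[]]; last by move=> y sy; apply: cA; exists s.
by rewrite lin_ext_gen; congr gen; apply/continuousEP.
Qed.

End Carriers.

Lemma push_val_incl (R : realType) (G : comPzRingType) (X : topologicalType)
    (A B : set X) (AB : A `<=` B) k (c : singular_chain R G A k) :
  push R G (subspace_val B) k (push R G (subspace_incl AB) k c) =
  push R G (subspace_val A) k c.
Proof.
apply: (@eq_linear_gen _ _ _
  (push R G (subspace_val B) k \o push R G (subspace_incl AB) k)) => s /=.
by rewrite !lin_ext_gen; congr gen; apply/continuousEP.
Qed.

Section Cycles.
Variables (R : realType) (G : comPzRingType).

Lemma corestrict_cycle (X : topologicalType) (A : set X) k
    (c : singular R G X k) : carrier c `<=` A ->
  c \in @cycles_pred G (singular R G X) k ->
  corestrict_chain R G A k c \in @cycles_pred G (singular R G A) k.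
Proof.
case: k c => [|k] c /corestrict_chainK cE; rewrite !unfold_in /= => /eqP c0.
  by rewrite -(chain_map_aug (push R G (subspace_val A))) cE; apply/eqP.
apply/eqP/(can_inj (@push_valK R G X A k)).
by rewrite (chain_map_bd (push R G (subspace_val A))) cE raddf0.
Qed.

Lemma lc_fill n (X : topologicalType) (x : X) (U : set X) :
  lc R G n X -> nbhs x U ->
  exists V : set X, [/\ V `<=` U, nbhs x V &
    forall k, (k <= n)%N -> forall c : singular R G X k,
      c \in @cycles_pred G (singular R G X) k -> carrier c `<=` V ->
    exists2 d : singular R G X k.+1, bd (singular R G X) k d = c &
      carrier d `<=` U].
Proof.
move=> + Ux => /(_ x U Ux)[V [VU [Vx HV]]]; exists V; split=> // k kn c cz cV.
pose z := Cycles (corestrict_cycle cV cz).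
have := HV k kn (\pi_(homology (singular R G V) k) z).
rewrite homology_mapE => /eqP.
rewrite -[0](raddf0 (\pi_(homology (singular R G U) k))).
rewrite -Quotient.idealrBE subr0 unfold_in => /asboolP[d dE].
exists (push R G (subspace_val U) k.+1 d); last exact: push_val_carrier.
rewrite -(chain_map_bd (push R G (subspace_val U))) dE /=.
by rewrite push_val_incl corestrict_chainK.
Qed.

End Cycles.

Lemma injective_card_le (T : Type) k n (v : 'I_k -> T) (A : set T) :
  injective v -> (forall i, A (v i)) -> (A #<= `I_n)%card -> (k <= n)%N.
Proof.
move=> vI vA An; rewrite -card_le_II (card_le_eql card_II).
have /card_le_eql <- : (range v #= [set: 'I_k])%card.
  by apply: inj_card_eq => i j _ _; exact: vI.
by apply: card_le_trans An; apply: subset_card_le => _ [i _ <-].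
Qed.

(** * From tuples of a cover to singular chains *)

Section NerveMap.
Variables (R : realType) (G : comPzRingType) (n : nat) (X : metricType R).
Local Notation S := (singular R G X).

(** One filling must serve every [z'] near [z]: a tuple may have many common points, and the bound
    is wanted at each. *)
Definition fills (lam lam' : X -> R) : Prop :=
  forall k, (k <= n)%N -> forall z (c : S k), c \in @cycles_pred G S k ->
    carrier c `<=` ball z (lam z) ->
  exists2 d : S k.+1, bd S k d = c &
    forall z', ball z (lam z) z' -> carrier d `<=` ball z' (lam' z').

Lemma lc_fills lam' : lc R G n X -> radius_function lam' ->
  exists lam, [/\ radius_function lam, forall x, lam x <= lam' x &
    fills lam lam'].
Proof.
move=> lcX [pos' lip'].
have /choice[V VP] x : exists V : set X,
  [/\ V `<=` ball x (lam' x / 8), nbhs x V &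
    forall k, (k <= n)%N -> forall c : S k, c \in @cycles_pred G S k ->
      carrier c `<=` V ->
    exists2 d : S k.+1, bd S k d = c & carrier d `<=` ball x (lam' x / 8)].
  by apply: lc_fill => //; apply: nbhsx_ballx; have := pos' x; lra.
have [|lam1 lam1P lam1V] := @cover_radius _ X [set (V x)^° | x in setT].
  split=> [_ [x _ <-]|]; first exact: open_interior.
  apply/seteqP; split=> // x _; exists (V x)^°; first by exists x.
  by have [_ /nbhs_interior/nbhs_singleton] := VP x.
exists (fun x => Num.min (lam1 x) (lam' x)); split=> [|x|k kn z c cz cc].
- exact: radius_min.
- by rewrite ge_min lexx orbT.
have [_ [x _ <-] zV] := lam1V z.
have {}zV : ball z (Num.min (lam1 z) (lam' z)) `<=` V x.
  move=> y; rewrite mballE lt_min => /andP[zy _].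
  by apply: interior_subset; apply: zV; rewrite mballE.
have [VB _ Vfill] := VP x; have [|d dc dB] := Vfill k kn c cz.
  exact: subset_trans zV.
exists d => // z' /zV/VB; rewrite mballE => xz'.
(* Both [z'] and [d] lie within [lam' x / 8] of [x], and [lam' z'] is at least [7/8 * lam' x], more
   than the [lam' x / 4] required. *)
apply: subset_trans dB _ => y; rewrite !mballE => xy.
have := metric_triangle z' x y; rewrite (metric_sym z' x).
by have := lip' x z'; have := pos' x; lra.
Qed.

Lemma small_radius_cover lam : covdim_lt X n.+1 -> radius_function lam ->
  exists V : set (set X), [/\ open_cover V,
    forall B z, V B -> B z -> B `<=` ball z (lam z) &
    forall x, ([set B | V B /\ B x] #<= `I_n.+1)%card].
Proof.
move=> dimX [pos lip].
have [|V Vcov [Vref Vord]] := dimX [set ball x (lam x / 4) | x in setT].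
  split=> [_ [x _ <-]|]; first exact: open_mball.
  apply/seteqP; split=> // x _; exists (ball x (lam x / 4)); first by exists x.
  by rewrite mballE mdistxx; have := pos x; lra.
exists V; split=> // B z /Vref[_ [x _ <-] Bx] /Bx; rewrite mballE => xz.
move=> y /Bx; rewrite !mballE => xy.
have := metric_triangle z x y; rewrite (metric_sym z x).
by have := lip x z; have := pos x; lra.
Qed.

Definition meet_at (V : set (set X)) k (v : 'I_k -> set X) (z : X) : Prop :=
  forall i, V (v i) /\ v i z.

Lemma nerve_chain_map lam : covdim_lt X n.+1 -> lc R G n X ->
  radius_function lam ->
  exists (V : set (set X)) (F : forall k, ('I_k.+1 -> set X) -> S k),
    [/\ open_cover V, forall B z, V B -> B z -> B `<=` ball z (lam z),
        forall v z, meet_at V v z -> aug S (F 0 v) = 1,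
        forall k v z, meet_at V v z -> bd S k (F k.+1 v) = tuple_bd (F k) v &
        forall k (v : 'I_k.+1 -> set X) z, meet_at V v z ->
          carrier (F k v) `<=` ball z (lam z)].
Proof.
move=> dimX lcX lamr.
have /choice[next nextP] mu : exists mu', radius_function mu ->
    [/\ radius_function mu', forall x, mu' x <= mu x & fills mu' mu].
  have [/(lc_fills lcX)[mu' ?]|?] := pselect (radius_function mu);
    last by exists mu.
  by exists mu'.
pose mu j := iter j next lam.
have mur j : radius_function (mu j) by elim: j => // j /nextP[].
have mu_le i j x : (i <= j)%N -> mu j x <= mu i x.
  move=> /subnK <-; elim: (j - i)%N => // m /(le_trans _); apply.
  by have [_ + _] := nextP _ (mur (m + i)%N); apply.
have mu_fill j : fills (mu j.+1) (mu j) by have [] := nextP _ (mur j).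
have [V [Vcov Vmu Vord]] := small_radius_cover dimX (mur n).
pose N k (v : 'I_k.+1 -> set X) := exists z, meet_at V v z.
(* Vertices start with the smallest radius [mu n], and each filling moves one level up, towards
   [mu 0], which is [lam]. *)
pose Q k (v : 'I_k.+1 -> set X) (c : S k) :=
  forall z, meet_at V v z -> carrier c `<=` ball z (mu (n - k)%N z).
have carrierZ k (A : set X) (c : S k) (a : G) :
    carrier c `<=` A -> carrier (a *: c) `<=` A.
  by move=> /carrierP cA; apply/carrierP; exact: rpredZ.
have [||||k v c [z vz] vI cQ cz|F [Faug Fbd _ FQ]] :=
  @alternating_tower G (set X) S N Q.
- by move=> m k v h [z vz]; exists z => i; exact: vz.
- by move=> k v z _; rewrite carrier0.
- move=> k s v c cQ z vsz; apply: carrierZ; apply: cQ => i.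
  by have := vsz (s^-1%g i); rewrite /= permKV.
- move=> v [z vz].
  have [x v0x] : exists x, v ord0 x by exists z; have [] := vz ord0.
  exists (gen G (cst x : simplex R X 0)); first exact: lin_ext_gen.
  move=> y vy; apply: subset_trans (@carrier_gen _ _ _ _ _) _ => _ [t _ <-].
  rewrite subn0; have [V0 v0y] := vy ord0.
  exact: Vmu V0 v0y _ v0x.
(* At most [n.+1] distinct members of [V] contain [z], so only cycles of degree [k < n] are filled,
   and the subtraction [n - k.+1] is not truncated. *)
- have kn : (k.+2 <= n.+1)%N := injective_card_le vI vz (Vord z).
  have nk : (n - k = (n - k.+1).+1)%N by rewrite subnSK.
  have [|d dE dQ] := @mu_fill (n - k.+1)%N k (ltnW kn) z _ cz.
    apply/carrierP; apply: rpred_sum => i _; apply: rpredZ; apply/carrierP.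
    by rewrite -nk; apply: cQ => j; exact: vz.
  (* [d] was built at one common point [z]; any other [z'] lies with it in [v ord0], which is small
     enough for [fills] to apply. *)
  exists d => // z' vz'; apply: dQ; rewrite mballE.
  have [V0 v0z] := vz ord0; have [_ v0z'] := vz' ord0.
  have := Vmu _ _ V0 v0z _ v0z'; rewrite mballE => /lt_le_trans; apply.
  by apply: mu_le; rewrite -nk leq_subr.
exists V, F; split=> // [B z VB Bz|v z vz|k v z vz|k v z vz].
- apply: subset_trans (Vmu B z VB Bz) _ => y; rewrite !mballE.
  by move=> /lt_le_trans; apply; exact: (mu_le 0%N).
- by apply: Faug; exists z.
- by apply: Fbd; exists z.
- apply: subset_trans (FQ k v _ z vz) _; first by exists z.
  by move=> y; rewrite !mballE => /lt_le_trans; apply; exact: (mu_le 0%N).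
Qed.

End NerveMap.

(** * Extending open sets to the ambient space *)

Section Extension.
Variables (R : realType) (X Y : metricType R) (e : X -> Y).

(** The usual extension: the points strictly nearer to the image of [B] than to that of its
    complement, the distance to the empty set being infinite. *)
Definition extend (B : set X) : set Y :=
  [set y | exists x r, mdist y (e x) < r /\ e @^-1` ball y r `<=` B].

Lemma open_extend B : open (extend B).
Proof.
apply/open_mdistP => y [x [r [yx rB]]].
(* Moving [y] by less than half the slack [r - mdist y (e x)] and lowering [r] by that half keeps
   both conditions. *)
exists ((r - mdist y (e x)) / 2) => [|y' yy']; first lra.
exists x, ((r + mdist y (e x)) / 2); split.
  by have := metric_triangle y' y (e x); rewrite (metric_sym y' y); lra.
move=> x'; rewrite /= mballE => y'x'; apply: rB; rewrite /= mballE.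
by have := metric_triangle y y' (e x'); lra.
Qed.

Lemma sub_extend B C : open C -> e @^-1` C `<=` B ->
  forall x, C (e x) -> extend B (e x).
Proof.
move=> /open_mdistP oC CB x /oC[r r0 rC]; exists x, r.
split; first by rewrite mdistxx.
by move=> x'; rewrite /= mballE => /rC/CB.
Qed.

Lemma extend_preimage B : e @^-1` extend B `<=` B.
Proof.
move=> x [x' [r [xx' rB]]]; apply: rB.
by rewrite /= mballE mdistxx; have := mdist_ge0 (e x) (e x'); lra.
Qed.

(* The point belonging to the smallest of the radii works for all the sets. *)
Lemma extend_meet k (v : 'I_k.+1 -> set X) y :
  (forall i, extend (v i) y) -> exists x, forall i, v i x.
Proof.
move=> /choice[x /choice[r xr]].
have [i _ imin] := arg_minP r (isT : xpredT (ord0 : 'I_k.+1)).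
exists (x i) => j; have [_] := xr j; apply; rewrite /= mballE.
by have [+ _] := xr i; move=> /lt_le_trans; apply; exact: imin.
Qed.

End Extension.

(** * From singular simplexes to tuples *)

Section Vertices.
Variable R : realType.

Lemma vertex_subproof k (i : 'I_k.+1) :
  (\row_j (j == i)%:R : 'rV[R]_k.+1) \in std_simplex R k.
Proof.
apply/mem_set; split=> [j|]; first by rewrite mxE ler0n.
rewrite (bigD1 i)//= mxE eqxx big1 ?addr0// => j /negbTE ji.
by rewrite mxE ji.
Qed.

Definition vertex k (i : 'I_k.+1) : std_simplex R k :=
  SigSub (vertex_subproof i).

Lemma simplex_fun_vertex m k (h : 'I_m.+1 -> 'I_k.+1) i :
  simplex_fun h (vertex i) = vertex (h i).
Proof.
apply/val_inj/rowP => j /=; rewrite !mxE.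
under eq_bigr do rewrite mxE.
have [->|jhi] := eqVneq j (h i).
  by rewrite (bigD1 i)//= eqxx big1 ?addr0// => i' /andP[_ /negbTE->].
rewrite big1// => i' /eqP hi'; have [i'i|//] := eqVneq i' i.
by rewrite -hi' i'i eqxx in jhi.
Qed.

End Vertices.

Section VertexChainMap.
Variables (R : realType) (G : comPzRingType) (W : topologicalType) (K : Type).
Variables (alpha : set (set W)) (D : chain_complex G) (p : W -> K).
Variable F : forall k, ('I_k.+1 -> K) -> D k.

Definition vertices k (s : simplex R W k) (i : 'I_k.+1) : K :=
  p (s (vertex R i)).

Lemma vertices_face m k (s : simplex R W k) (h : 'I_m.+1 -> 'I_k.+1) :
  vertices (face s h) = vertices s \o h.
Proof. by apply/funext => i; rewrite /vertices /= simplex_fun_vertex. Qed.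

Hypothesis F_aug : forall s : simplex R W 0, small alpha s ->
  aug D (F (vertices s)) = 1.
Hypothesis F_bd : forall k (s : simplex R W k.+1), small alpha s ->
  bd D k (F (vertices s)) =
  \sum_(i < k.+2) (-1) ^+ i *: F (vertices s \o lift i).

(** Only the labels of the vertices enter, so faces become subtuples. The map is linear on all
    chains, but [F_aug] and [F_bd] speak of small simplexes only. *)
Definition vertex_map k : {linear singular_chain R G W k -> D k} :=
  lin_ext (fun s => F (vertices s)).

Definition vertex_small_map k : {linear small_chain R G alpha k -> D k} :=
  vertex_map k \o \val.

Lemma vertex_small_map_bd k c :
  vertex_small_map k (small_bd R G alpha k c) =
  bd D k (vertex_small_map k.+1 c).
Proof.
apply: (@eq_linear_fsupp _ _ _ (vertex_map k \o singular_bd R G W k)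
  (bd D k \o vertex_map k.+1)) => s /(small_fsupp (c := c)) ss /=.
rewrite singular_bd_gen [vertex_map _ _ in RHS]lin_ext_gen F_bd// linear_sum/=.
apply: eq_bigr => i _; rewrite linearZ/= [vertex_map _ _]lin_ext_gen.
by rewrite vertices_face.
Qed.

Lemma vertex_small_map_aug c :
  aug D (vertex_small_map 0 c) = small_aug R G alpha c.
Proof.
apply: (@eq_linear_fsupp _ _ _ (aug D \o vertex_map 0) (singular_aug R G W)).
move=> s /(small_fsupp (c := c)) ss /=.
by rewrite [vertex_map _ _]lin_ext_gen F_aug// [RHS]lin_ext_gen.
Qed.

Definition vertex_morphism : chain_morphism (small_singular R G alpha) D :=
  @ChainMorphism G (small_singular R G alpha) D vertex_small_map
    vertex_small_map_bd vertex_small_map_aug.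

End VertexChainMap.

(** * Assembly of the chain morphism, and closeness *)

Theorem proposition4p4 (R : realType) (G : comPzRingType) (n : nat)
    (X : metricType R) :
  has_covdim X n -> lc R G n X -> AANR G X.
Proof.
move=> [dimX _] lcX Y e [_ e_open _] U Ucov.
have [lam lamr lamU] := cover_radius Ucov.
have [V [F [[Vopen Vcov] Vlam Faug Fbd Fcar]]] := nerve_chain_map dimX lcX lamr.
have [|rho [rho_lip rho_gt0 rhoV]] :=
    @lebesgue_function R Y [set extend e B | B in V].
  by move=> _ [B _ <-]; exact: open_extend.
(* Points of [Y] are labelled by members of [V], with default [set0] where [rho] is not positive. *)
have /choice[p pP] w : exists B,
    0 < rho w -> V B /\ ball w (rho w) `<=` extend e B.
  have [/rhoV[_ [B VB <-] ?]|?] := pselect (0 < rho w); last by exists set0.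
  by exists B.
pose W := \bigcup_(B in V) extend e B.
have rhoW w : W w -> 0 < rho w.
  by move=> [B VB Bw]; apply: (rho_gt0 (extend e B)) => //; exists B.
have eW : range e `<=` W.
  move=> _ [x _ <-]; have [B VB Bx] : (\bigcup_(B in V) B) x by rewrite Vcov.
  exists B => //; have [C oC CB] := (e_open B).1 (Vopen _ VB).
  by apply: (sub_extend oC) => //; rewrite ?CB// -CB in Bx *.
pose alpha : set (set W) := [set set_val @^-1` ball w (rho w / 4) | w in W].
(* On the ball of radius [rho w / 4] about [w] the function [rho] exceeds the
   diameter, so that the set chosen at any of its points covers the ball. *)
have pW w w' : W w -> ball w (rho w / 4) w' ->
    V (p w') /\ ball w (rho w / 4) `<=` extend e (p w').
  move=> /rhoW w0; rewrite mballE => ww'.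
  have lipw := rho_lip w w'.
  have [|Vp pB] := pP w'; first lra.
  split=> // y; rewrite mballE => wy; apply: pB; rewrite mballE.
  by have := metric_triangle w' w y; rewrite (metric_sym w' w); lra.
(* The second clause keeps all of [s], not just its vertices, in the extended sets, as closeness
   requires. *)
have smallV k (s : simplex R W k) : small alpha s ->
    exists z, meet_at V (vertices (p \o set_val) s) z /\
      forall i t, extend e (vertices (p \o set_val) s i) (set_val (s t)).
  move=> [_ [w Ww <-] sw].
  have ws t : ball w (rho w / 4) (set_val (s t)) by apply: sw; exists t.
  have ww : ball w (rho w / 4) w.
    by rewrite mballE mdistxx; have := rhoW _ Ww; lra.
  have [z vz] : exists z, forall i, vertices (p \o set_val) s i z.
    apply: (@extend_meet _ _ _ e _ _ w) => i.
    by have [_] := pW w _ Ww (ws (vertex R i)); exact.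
  exists z; split=> [i|i t]; have [Vp pB] := pW w _ Ww (ws (vertex R i)) => //.
  exact: pB.
have Fvaug (s : simplex R W 0) : small alpha s ->
    aug (singular R G X) (F 0 (vertices (p \o set_val) s)) = 1.
  by move=> /smallV[z [vz _]]; exact: Faug vz.
have Fvbd k (s : simplex R W k.+1) : small alpha s ->
    bd (singular R G X) k (F k.+1 (vertices (p \o set_val) s)) =
    \sum_(i < k.+2) (-1) ^+ i *: F k (vertices (p \o set_val) s \o lift i).
  by move=> /smallV[z [vz _]]; exact: Fbd vz.
exists W, eW, alpha, (vertex_morphism Fvaug Fvbd); split.
- apply/set_nbhsP; exists W; split=> //; apply: bigcup_open => B _.
  exact: open_extend.
- split=> [_ [w _ <-]|].
    apply: (@open_comp _ _ set_val) => [? _|]; last exact: open_mball.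
    exact: initial_continuous.
  apply/seteqP; split=> // w _; have Ww := set_valP w.
  exists (set_val @^-1` ball (set_val w) (rho (set_val w) / 4)).
    by exists (set_val w).
  by rewrite /= mballE mdistxx; have := rhoW _ Ww; lra.
move=> k s [_ [A alphaA <-] sA].
pose es := push_simplex (corestrict eW) s.
have [|z [vz es_ext]] := smallV k es.
  by exists A => // _ [t _ <-]; apply: sA; exists t.
(* One [z] serves all faces of [s], since subtuples of its labels still meet at [z]. *)
have [B UB zB] := lamU z; exists B => // m t tsmall [h _ tE].
rewrite subUset; split; apply: subset_trans zB.
  rewrite /= !lin_ext_gen.
  have -> : push_simplex (corestrict eW) t = face es h.
    by rewrite tE; apply/continuousEP.
  by rewrite vertices_face; apply: Fcar => i; exact: vz.
apply: subset_trans (@carrier_gen _ _ _ _ _) _; rewrite tE.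
apply: subset_trans (@face_range _ _ _ _ _ _) _ => _ [q _ <-].
(* The simplex lies in [X], so the label of its first vertex contains it as well as [z]. *)
have [V0 z0] := vz ord0; apply: (Vlam _ _ V0 z0).
by apply: (@extend_preimage _ _ _ e); exact: es_ext.
Qed.
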